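(* Let $n \ge 1$ and let $T \subset \mathbb{Z}^n$ be a tile. Then there exists $d \ge n$ such that $T$ tiles $\mathbb{Z}^d$.
   Context: A tile is a finite non-empty subset of $\mathbb{Z}^n$ for some $n$. For $d \ge n$, regard $T$ as a subset of $\mathbb{Z}^d$ via the embedding $x \mapsto (x,0,\dots,0)$. A copy of $T$ in $\mathbb{Z}^d$ is a subset of $\mathbb{Z}^d$ isometric to $T$ (with respect to the Euclidean metric). We say $T$ tiles $\mathbb{Z}^d$ if $\mathbb{Z}^d$ can be partitioned into copies of $T$. *)

(* Defs.v *)
From HB Require Import structures.
From mathcomp Require Import all_boot all_order all_algebra.
From mathcomp Require Import finmap.
Set Implicit Arguments. Unset Strict Implicit. Unset Printing Implicit Defensive.
Import Order.TTheory GRing.Theory Num.Theory.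
Local Open Scope ring_scope.
Local Open Scope fset_scope.

Definition pt (d : nat) := {ffun 'I_d -> int}.

(* Squared Euclidean distance on Z^d (isometry w.r.t. the Euclidean metric
   is the same as preserving squared distances). *)
Definition dist2 (d : nat) (x y : pt d) : int :=
  \sum_(i < d) (x i - y i) ^+ 2.

Definition embed (n d : nat) (x : pt n) : pt d :=
  [ffun i : 'I_d => if (insub (val i) : option 'I_n) is Some j then x j else (0 : int)].

Definition is_tile (n : nat) (T : {fset pt n}) : Prop := T != fset0.

Definition is_copy (n d : nat) (T : {fset pt n}) (S : pt d -> Prop) : Prop :=
  exists f : pt d -> pt d,
    (forall x, x \in T -> S (f (embed d x))) /\
    (forall y, S y -> exists2 x, x \in T & f (embed d x) = y) /\
    (forall x y, x \in T -> y \in T ->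
       dist2 (f (embed d x)) (f (embed d y)) = dist2 (embed d x) (embed d y)).

Definition tiles (n : nat) (T : {fset pt n}) (d : nat) : Prop :=
  exists (I : Type) (P : I -> pt d -> Prop),
    (forall i, @is_copy n d T (P i)) /\
    (forall z : pt d, exists! i, P i z).

(* Main.v *)
Require Import Defs.
From mathcomp Require Import all_boot all_order all_algebra.
From mathcomp Require Import finmap.
From mathcomp Require Import finfield zify ring.
From Stdlib Require Import Classical.

Set Implicit Arguments.
Unset Strict Implicit.
Unset Printing Implicit Defensive.

(** Let [t = #|T|] and let [X] be the torus (Z/k)^n for a suitable [k]. Translates of [T] in [X]
cover every point exactly [t] times, and for each prime [p | t] some multiset of translates covers
every point [1] mod [p] times. It suffices to partition a power of [X] into translates of [T] placed
along single coordinates.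

Work in X^N with sets depending on finitely many coordinates, and call such a set good if it is a
finite disjoint union of copies of tiles (thickened by the coordinates not involved). Multiplying by
a fresh coordinate turns goodness into a game: given tiles [A_1, ..., A_N] we name disjoint pieces
[P_1, ..., P_N] of a set [S], the opponent names [y] in [X], and the [P_i] with [y] in [A_i] are
removed; if every outcome is good then [S] is good. The [t]-fold cover removes exactly [t] of the
named pieces, and the mod [p] covers combine to remove [1] mod [t] of them.

Splitting each of several tiles in two gives a cube whose edges are good. Removing pieces so that
equally many even and odd vertices disappear leaves a good set, whence a brick minus a single small
cell is good. Finally the game tiles everything except a set that is sparse in some coordinates,
shrinks that set to boundedly many tiny cells, absorbs each of them with a line, and repairs the
damage with the previous fact. *)

(** * Counting lemmas for choosing indices and coordinates *)

Lemma inj_into (K I : finType) (S : {set I}) :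
  #|K| <= #|S| -> exists2 w : K -> I, injective w & forall k, w k \in S.
Proof.
move=> KS; exists (fun k => enum_val (widen_ord KS (enum_rank k))) => [|k].
  move=> k k' /enum_val_inj /(congr1 val) /= /ord_inj; exact: enum_rank_inj.
exact: enum_valP.
Qed.

Lemma card_bigcup_le (I T : finType) (P : pred I) (S : I -> {set T}) k :
  (forall i, P i -> #|S i| <= k) -> #|\bigcup_(i | P i) S i| <= k * #|[set i | P i]|.
Proof.
move=> hS; rewrite mulnC -sum_nat_const.
have -> : \sum_(i in [set i | P i]) k = \sum_(i | P i) k by apply: eq_bigl => i; rewrite inE.
elim/big_rec2: _ => [|i n U Pi UN]; first by rewrite cards0.
by apply: leq_trans (leq_card_setU _ _) _; apply: leq_add (hS i Pi) UN.
Qed.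

(** A point within Hamming distance two of [c] spoils at most two coordinates, so [S] spoils fewer
    than [b] in all. This picks the direction of a line that leaves a sparse hole. *)
Lemma free_direction (X : finType) b (S : {set {ffun 'I_b -> X}}) (c : {ffun 'I_b -> X}) :
  2 * #|S| < b ->
  exists l, forall w, w \in S -> #|[set j | w j != c j]| <= 2 -> w l = c l.
Proof.
move=> Sb; pose D w := [set j | w j != c j].
pose B := \bigcup_(w | (w \in S) && (#|D w| <= 2)) D w.
have /card_gt0P[l] : 0 < #|~: B|.
  rewrite cardsCs setCK card_ord subn_gt0; apply: leq_ltn_trans Sb.
  apply: leq_trans (card_bigcup_le (k := 2) _) _ => [w /andP[]//|].
  by rewrite leq_mul2l; apply/subset_leq_card/subsetP=> w; rewrite inE => /andP[].
rewrite inE => lB; exists l => w wS w2; apply/eqP; apply: contraNT lB => wl.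
by apply/bigcupP; exists w; rewrite ?wS // inE.
Qed.

(** Each pair of distinct points of [Z] reserves one coordinate where they differ; [mu] is chosen
    among the unreserved ones. *)
Lemma separating_coords (X : finType) m r (Z : {set {ffun 'I_r -> X}}) :
  m + #|Z| * #|Z| <= r ->
  exists2 mu : 'I_m -> 'I_r, injective mu &
    forall z z', z \in Z -> z' \in Z -> (forall j, j \notin codom mu -> z j = z' j) -> z = z'.
Proof.
move=> mr; pose sep (p : {ffun 'I_r -> X} * {ffun 'I_r -> X}) := [pick j | p.1 j != p.2 j].
pose S := [set j | [exists (p | p \in setX Z Z), sep p == Some j]].
have cS : #|S| <= #|Z| * #|Z|.
  have <- := card_imset (mem S) (@Some_inj _); rewrite -cardsX.
  apply: leq_trans (leq_imset_card sep (mem (setX Z Z))).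
  apply/subset_leq_card/subsetP=> _ /imsetP[j jS ->].
  move: jS; rewrite inE => /exists_inP[p pZ /eqP pj].
  by rewrite -pj imset_f.
have [|mu mu_inj muS] := @inj_into 'I_m _ (~: S).
  by rewrite cardsCs setCK !card_ord; lia.
exists mu => // z z' zZ z'Z hz; apply/eqP/negPn/negP => zz'.
have [j Sj] : exists j, sep (z, z') = Some j.
  rewrite /sep; case: pickP => [j _|h]; first by exists j.
  by case/negP: zz'; apply/eqP/ffunP=> j; have /negbFE/eqP := h j.
have jS : j \in S by rewrite inE; apply/exists_inP; exists (z, z'); rewrite ?inE ?zZ ?z'Z ?Sj.
move: Sj; rewrite /sep; case: pickP => // k /= + [kj]; rewrite kj hz ?eqxx //.
by apply: contraL jS => /codomP[l ->]; have := muS l; rewrite inE.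
Qed.

(** * Finite disjoint unions of bricks *)

Section Bricks.

Variables (X : finType) (F : {pred {set X}}).

Local Notation point := (nat -> X).

Definition upd (x : point) (i : nat) (a : X) : point :=
  fun j => if j == i then a else x j.

(** Points are infinite sequences, so a fresh coordinate is always at hand; [dep] bounds the
    coordinates in use. *)
Definition dep (d : nat) (V : Type) (f : point -> V) : Prop :=
  forall x y, (forall j, j < d -> x j = y j) -> f x = f y.

Definition indep (i : nat) (V : Type) (f : point -> V) : Prop :=
  forall x a, f (upd x i a) = f x.

(* [tiled d f]: [f] is a sum of indicators of bricks [{x in C | x i \in A}] with [A] a tile and [C]
   independent of coordinate [i], everything living on the coordinates below [d]. *)
Inductive tiled (d : nat) : (point -> nat) -> Prop :=
| tiled0 f : (forall x, f x = 0) -> tiled d f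
| tiledS f g (C : pred point) i (A : {set X}) :
    dep d C -> i < d -> indep i C -> A \in F -> tiled d g ->
    (forall x, f x = (C x && (x i \in A)) + g x) -> tiled d f.

Definition good (f : point -> nat) : Prop := exists d, tiled d f.

Lemma dep_leq d e (V : Type) (f : point -> V) : d <= e -> dep d f -> dep e f.
Proof. by move=> de df x y xy; apply: df => j jd; apply: xy; apply: leq_trans de. Qed.

Lemma dep_indep d i (V : Type) (f : point -> V) : d <= i -> dep d f -> indep i f.
Proof.
move=> di df x a; apply: df => j jd; rewrite /upd; case: eqP => // ji.
by move: jd; rewrite ji ltnNge di.
Qed.

Lemma tiled_ext d f g : f =1 g -> tiled d f -> tiled d g.
Proof.
move=> fg tf; case: tf fg => [{}f f0|{}f h C i A dC id iC AF th fE] fg.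
  by apply: tiled0 => x; rewrite -fg f0.
by apply: (tiledS dC id iC AF th) => x; rewrite -fg.
Qed.

Lemma tiled_leq d e f : d <= e -> tiled d f -> tiled e f.
Proof.
move=> de; elim=> [g g0|g h C i A dC id iC AF _ th gE]; first exact: tiled0.
exact: (tiledS (dep_leq de dC) (leq_trans id de) iC AF th gE).
Qed.

Lemma tiledD d f g : tiled d f -> tiled d g -> tiled d (fun x => f x + g x).
Proof.
move=> tf tg; elim: tf => [h h0|h h' C i A dC id iC AF _ th hE].
  by apply: tiled_ext tg => x; rewrite h0.
by apply: (tiledS dC id iC AF th) => x; rewrite hE addnA.
Qed.

Lemma good_ext f g : f =1 g -> good f -> good g.
Proof. by move=> fg [d /(tiled_ext fg)]; exists d. Qed.

Lemma good0 : good (fun=> 0).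
Proof. by exists 0; apply: tiled0. Qed.

Lemma goodD f g : good f -> good g -> good (fun x => f x + g x).
Proof.
move=> [d tf] [e tg]; exists (maxn d e).
by apply: tiledD; [apply: tiled_leq tf; rewrite leq_maxl|apply: tiled_leq tg; rewrite leq_maxr].
Qed.

Lemma good_sum (I : Type) (r : seq I) (P : pred I) (f : I -> point -> nat) :
  (forall i, P i -> good (f i)) -> good (fun x => \sum_(i <- r | P i) f i x).
Proof.
move=> gf; elim: r => [|i r IH]; first by apply: good_ext good0 => x; rewrite big_nil.
case Pi: (P i); last by apply: good_ext IH => x; rewrite big_cons Pi.
by apply: good_ext (goodD (gf i Pi) IH) => x; rewrite big_cons Pi.
Qed.

Lemma good_brick (C : pred point) i (A : {set X}) :
  (exists d, dep d C) -> indep i C -> A \in F -> good (fun x => C x && (x i \in A)).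
Proof.
move=> [d dC] iC AF; exists (maxn d i.+1).
have t0 : tiled (maxn d i.+1) (fun=> 0) by apply: tiled0.
apply: (tiledS _ _ iC AF t0) => [||x]; last by rewrite addn0.
- by apply: dep_leq dC; rewrite leq_maxl.
- by rewrite leq_maxr.
Qed.

(** No brick of [f] uses coordinate [e], so fixing it only shrinks the bases [C]. Hence different
    values of that coordinate may carry different tilings. *)
Lemma tiled_slice d e (y : X) f :
  d <= e -> tiled d f -> tiled e.+1 (fun x => (x e == y) * f x).
Proof.
move=> de; elim=> [g g0|g h C i A dC id iC AF _ th gE].
  by apply: tiled0 => x; rewrite g0 muln0.
have ie : i < e by apply: leq_trans de.
apply: (@tiledS _ _ _ (fun x => (x e == y) && C x) i A _ _ _ AF th) => [u v uv||u a|x].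
- by rewrite (uv e) // (dC u v) // => j jd; apply: uv; apply: leq_trans jd (leqW de).
- exact: leqW.
- by rewrite iC /upd gtn_eqF.
- by rewrite gE mulnDr mulnb andbA.
Qed.

(* The opponent's answer [y] is read off a coordinate [e] on which nothing in play depends yet. *)
Lemma good_play (K : finType) (A : K -> {set X}) (P : K -> pred point)
    (R : X -> point -> nat) :
  (forall k, A k \in F) -> (forall k, exists d, dep d (P k)) ->
  (forall y, good (R y)) ->
  exists e0, forall e, e0 <= e ->
    good (fun x => R (x e) x + \sum_k (P k x && (x e \in A k))).
Proof.
move=> AF /fin_all_exists [dP hP] /fin_all_exists [dR hR].
exists (maxn (\max_k dP k) (\max_y dR y)) => e.
rewrite geq_max => /andP[/bigmax_leqP Pe /bigmax_leqP Re].
apply: goodD.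
  have : good (fun x => \sum_y (x e == y) * R y x).
    apply: good_sum => y _; exists e.+1.
    by apply: tiled_slice (hR y); apply: Re.
  apply: good_ext => x; rewrite (bigD1 (x e)) //= eqxx mul1n big1 ?addn0 // => y.
  by rewrite eq_sym => /negPf ->.
apply: good_sum => k _; apply: good_brick => //; first by exists (dP k); apply: hP.
by apply: dep_indep (hP k); apply: Pe.
Qed.

(** When all answers [y] decompose the same [f], the function given by [good_play] is [f] itself. *)
Lemma good_move (K : finType) (A : K -> {set X}) (P : K -> pred point)
    (R : X -> point -> nat) (f : point -> nat) :
  (forall k, A k \in F) -> (forall k, exists d, dep d (P k)) ->
  (forall y, good (R y)) ->
  (forall y x, f x = R y x + \sum_k (P k x && (y \in A k))) -> good f.
Proof.
move=> AF dP gR fE; have [e0 /(_ e0 (leqnn _))] := good_play AF dP gR.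
by apply: good_ext => x; rewrite (fE (x e0)).
Qed.

(** State of the game: [H] is never touched, and [J] indexes the named pieces not yet removed. *)
Definition residue (I : finType) (H : point -> nat) (P : I -> pred point) (J : {set I}) :
  point -> nat := fun x => H x + \sum_(i in J) P i x.

(** The injection [w] assigns a piece of [S] to each tile, and the answer [y] removes the pieces
    whose tile contains [y]. Only the number removed is recorded, so every [D] of that size must be
    handled. *)
Lemma good_remove (K I : finType) (A : K -> {set X}) (H : point -> nat)
    (P : I -> pred point) (J S : {set I}) :
  (forall k, A k \in F) -> (forall i, exists d, dep d (P i)) ->
  S \subset J -> #|K| <= #|S| ->
  (forall (y : X) (D : {set I}), D \subset S -> #|D| = #|[set k | y \in A k]| ->
     good (residue H P (J :\: D))) ->
  good (residue H P J).
Proof.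
move=> AF dP SJ /inj_into[w w_inj wS] hD.
pose D y := w @: [set k | y \in A k].
have DS y : D y \subset S by apply/subsetP=> i /imsetP[k _ ->].
apply: (good_move (P := fun k => P (w k)) (R := fun y => residue H P (J :\: D y)) AF) => // [y|y x].
  by apply: (hD y) => //; rewrite card_imset.
rewrite /residue -addnA; congr (_ + _).
rewrite (big_setID (D y)) /= addnC; congr (_ + _).
have -> : J :&: D y = D y by apply/setIidPr; apply: subset_trans (DS y) SJ.
rewrite big_imset /=; last by move=> ? ? _ _; apply: w_inj.
rewrite [LHS]big_mkcond /=; apply: eq_bigr => k _; rewrite inE.
by case: ifP; rewrite ?andbT ?andbF.
Qed.

Definition window (b : nat) (x : point) : {ffun 'I_b -> X} := [ffun j : 'I_b => x j].

Definition glue (b : nat) (w : {ffun 'I_b -> X}) (x : point) : point :=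
  fun j => oapp w (x j) (insub j).

Lemma glueE b w x (j : 'I_b) : glue w x j = w j.
Proof. by rewrite /glue valK. Qed.

Lemma glue_ge b (w : {ffun 'I_b -> X}) x j : b <= j -> glue w x j = x j.
Proof. by move=> bj; rewrite /glue insubF // ltnNge bj. Qed.

Lemma window_glue b (w : {ffun 'I_b -> X}) x : window b (glue w x) = w.
Proof. by apply/ffunP=> j; rewrite ffunE glueE. Qed.

Lemma window_dep b (V : Type) (f : {ffun 'I_b -> X} -> V) : dep b (fun x => f (window b x)).
Proof. by move=> x y xy; congr f; apply/ffunP=> j; rewrite !ffunE xy. Qed.

End Bricks.

(** * Removing one small cell from a brick *)

Section Cube.

Variables (X : finType) (F : {pred {set X}}).

Local Notation point := (nat -> X).
Local Notation good := (good F).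

Variables (L : finType) (lam : L -> nat) (lo hi : L -> {set X}).
Hypothesis lam_inj : injective lam.
Hypothesis lohi : forall l, lo l :&: hi l = set0.
Hypothesis lohiF : forall l, lo l :|: hi l \in F.

Definition cell (u : {set L}) : pred point :=
  fun x => [forall l, x (lam l) \in (if l \in u then hi l else lo l)].

Lemma cell_inj u v x : cell u x -> cell v x -> u = v.
Proof.
move=> /forallP hu /forallP hv; apply/setP=> l.
have := hu l; have := hv l; have /setP/(_ (x (lam l))) := lohi l; rewrite !inE.
by do 2 case: ifP => _; move=> + h1 h2 //; rewrite h1 h2.
Qed.

Lemma cell_dep u : exists d, dep d (cell u).
Proof.
exists (\max_l lam l).+1 => x y xy; apply: eq_forallb => l.
by rewrite (xy (lam l)) // ltnS leq_bigmax.
Qed.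

Lemma cell_indep u i : (forall l, i != lam l) -> indep i (cell u).
Proof. by move=> il x a; apply: eq_forallb => l; rewrite /upd eq_sym (negPf (il l)). Qed.

(** The halves [lo l] and [hi l] rejoin to a tile, so the two cells form one brick in direction
    [lam l]. *)
Lemma good_edge (B : pred point) (u : {set L}) (l : L) :
  (exists d, dep d B) -> (forall l, indep (lam l) B) -> l \notin u ->
  good (fun x => B x && (cell u x || cell (l |: u) x)).
Proof.
move=> [d dB] iB lu.
pose C x := B x && [forall l', (l' != l) ==> (x (lam l') \in (if l' \in u then hi l' else lo l'))].
have gC : good (fun x => C x && (x (lam l) \in lo l :|: hi l)).
  apply: good_brick => //.
    exists (maxn d (\max_l lam l).+1) => x y xy; congr (_ && _).
      by apply: dB => j jd; apply: xy; rewrite leq_max jd.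
    by apply: eq_forallb => l'; rewrite (xy (lam l')) // leq_max ltnS leq_bigmax ?orbT.
  move=> x a; rewrite /C iB; congr (_ && _); apply: eq_forallb => l'.
  by case: eqVneq => //= ll'; rewrite /upd (inj_eq lam_inj) (negPf ll').
apply: good_ext gC => x; congr nat_of_bool; rewrite /C -andbA; congr (_ && _).
apply/andP/orP => [[/forallP h]|].
  rewrite inE => /orP[xlo|xhi]; [left|right]; apply/forallP => l'.
    by have := h l'; case: eqVneq => [-> _|_ //]; rewrite (negPf lu).
  by have := h l'; rewrite !inE; case: eqVneq => [-> _|_ //=].
case=> /forallP h; split.
- by apply/forallP=> l'; rewrite h implybT.
- by have := h l; rewrite (negPf lu) inE => ->.
- by apply/forallP=> l'; have := h l'; rewrite !inE; case: eqVneq.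
- by have := h l; rewrite !inE eqxx /= => ->; rewrite orbT.
Qed.

Variables (C G : pred point) (i : nat) (A : {set X}).
Hypothesis C_dep : exists d, dep d C.
Hypothesis G_dep : exists d, dep d G.
Hypothesis C_i : indep i C.
Hypothesis C_lam : forall l, indep (lam l) C.
Hypothesis G_lam : forall l, indep (lam l) G.
Hypothesis i_lam : forall l, i != lam l.
Hypothesis AF : A \in F.

Let T : pred point := fun x => C x && (x i \in A).
Hypothesis GT : forall x, G x -> T x.

Variable ev : pred L.

(** The split of the brick [T] into [G] and its complement is one more direction of the cube, and
    over singletons the chosen side decides the parity. Thus [ev] is the parity in the enlarged
    cube. *)
Definition vertex (l : L) : pred point :=
  fun x => cell [set l] x && (if ev l then G x else T x && ~~ G x).

Let NG_dep : exists d, dep d (fun x => T x && ~~ G x).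
Proof.
case: C_dep => d dC; case: G_dep => e dG; exists (maxn i.+1 (maxn d e)) => x y xy.
rewrite /T (dC x y) ?(dG x y) ?(xy i) // ?leq_maxl // => j jd;
  by apply: xy; rewrite !leq_max jd ?orbT.
Qed.

Let NG_lam l : indep (lam l) (fun x => T x && ~~ G x).
Proof. by move=> x a; rewrite /T C_lam G_lam /upd (negPf (i_lam l)). Qed.

Lemma vertex_dep l : exists d, dep d (vertex l).
Proof.
case: (cell_dep [set l]) => d dc; case: NG_dep => e dN; case: G_dep => f dG.
exists (maxn d (maxn e f)) => x y xy; rewrite /vertex.
rewrite (dc x y); last by move=> j jd; apply: xy; rewrite !leq_max jd ?orbT.
case: (ev l); first by rewrite (dG x y) // => j jd; apply: xy; rewrite !leq_max jd ?orbT.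
by rewrite (dN x y) // => j jd; apply: xy; rewrite !leq_max jd ?orbT.
Qed.

(* Each removed pair [(a, b)] is repaired along the path [{a}, {a, b}, {b}] of the cube. *)
Lemma good_pairs (p : seq (L * L)) (C' : pred point) :
  (exists d, dep d C') -> indep i C' -> uniq (unzip1 p) -> uniq (unzip2 p) ->
  (forall q, q \in p -> ev q.1 && ~~ ev q.2) ->
  (forall q x, q \in p ->
     [|| cell [set q.1] x, cell [set q.2] x | cell [set q.1; q.2] x] -> C' x) ->
  exists2 f, good f & forall x, f x + \sum_(q <- p) (vertex q.1 x + vertex q.2 x) = T x && C' x.
Proof.
elim: p C' => [|[a b] p IH] C' dC' iC' /=.
  move=> _ _ _ _; exists (fun x => T x && C' x) => [|x]; last by rewrite big_nil addn0.
  have : good (fun x => (C x && C' x) && (x i \in A)).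
    apply: good_brick => //.
      case: C_dep dC' => d dC [e de]; exists (maxn d e) => x y xy.
      by rewrite (dC x y) ?(de x y) // => j jd; apply: xy; rewrite leq_max jd ?orbT.
    by move=> x z; rewrite C_i iC'.
  by apply: good_ext => x; rewrite /T andbAC.
move=> /andP[ap up1] /andP[bp up2] hev hC'.
have /andP[/= ea ob] : ev a && ~~ ev b by apply: (hev (a, b)); rewrite inE eqxx.
have ab : a != b by apply: contraNneq ob => <-.
(* The three cells of the path are set aside; the rest of [C'] goes to the induction hypothesis. *)
pose K x := [|| cell [set a] x, cell [set b] x | cell [set a; b] x].
have dK : exists d, dep d K.
  case: (cell_dep [set a]) (cell_dep [set b]) (cell_dep [set a; b]) => d1 h1 [d2 h2] [d3 h3].
  exists (maxn d1 (maxn d2 d3)) => x y xy; rewrite /K (h1 x y) ?(h2 x y) ?(h3 x y) //;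
    by move=> j jd; apply: xy; rewrite !leq_max jd ?orbT.
have iK : indep i K by move=> x z; rewrite /K !cell_indep.
have [|||||q x qp|f gf fE] // := IH (fun x => C' x && ~~ K x).
- case: dK dC' => d1 h1 [d2 h2]; exists (maxn d1 d2) => x y xy.
  by rewrite (h1 x y) ?(h2 x y) // => j jd; apply: xy; rewrite leq_max jd ?orbT.
- by move=> x z; rewrite iK iC'.
- by move=> q qp; apply: hev; rewrite inE qp orbT.
(* The path of [q] avoids that of [(a, b)]: first entries are distinct, second entries too, and [ev]
   tells first from second. *)
- move=> hq; rewrite (hC' q) ?inE ?qp ?orbT //=.
  have /andP[eq1 oq2] : ev q.1 && ~~ ev q.2 by apply: hev; rewrite inE qp orbT.
  have qa : q.1 != a by apply: contraNneq ap => <-; apply: map_f.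
  have qb : q.2 != b by apply: contraNneq bp => <-; apply: map_f.
  have q1b : q.1 != b by apply: contraNneq ob => <-.
  have q2a : q.2 != a by apply: contraNneq oq2 => ->.
  have key (u v : {set L}) l : l \in u -> l \notin v -> cell u x -> ~~ cell v x.
    by move=> lu lv cu; apply: contra lv => cv; rewrite -(cell_inj cu cv).
  rewrite /K !negb_or; case/or3P: hq => cu; apply/and3P; split.
  + by apply: (key _ _ q.1 _ _ cu); rewrite !inE ?eqxx // (negPf qa) ?(negPf q1b).
  + by apply: (key _ _ q.1 _ _ cu); rewrite !inE ?eqxx // (negPf qa) ?(negPf q1b).
  + by apply: (key _ _ q.1 _ _ cu); rewrite !inE ?eqxx // (negPf qa) ?(negPf q1b).
  + by apply: (key _ _ q.2 _ _ cu); rewrite !inE ?eqxx // (negPf qb) ?(negPf q2a).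
  + by apply: (key _ _ q.2 _ _ cu); rewrite !inE ?eqxx // (negPf qb) ?(negPf q2a).
  + by apply: (key _ _ q.2 _ _ cu); rewrite !inE ?eqxx // (negPf qb) ?(negPf q2a).
  + by apply: (key _ _ q.1 _ _ cu); rewrite !inE ?eqxx // (negPf qa) ?(negPf q1b).
  + by apply: (key _ _ q.1 _ _ cu); rewrite !inE ?eqxx // (negPf qa) ?(negPf q1b).
  + by apply: (key _ _ q.1 _ _ cu); rewrite !inE ?eqxx // (negPf qa) ?(negPf q1b).
have ba : b \notin [set a] by rewrite inE eq_sym.
have ab' : a \notin [set b] by rewrite inE.
(* Three cells with two sides each make six pieces. Without the two removed vertices they form an
   edge from [{a}] to [{a, b}] outside [G] and one from [{b}] to [{a, b}] inside [G]. *)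
have g1 := good_edge NG_dep NG_lam ba; have g2 := good_edge G_dep G_lam ab'.
exists (fun x => f x + (((T x && ~~ G x) && (cell [set a] x || cell (b |: [set a]) x))
  + (G x && (cell [set b] x || cell (a |: [set b]) x)))).
  by apply: goodD gf (goodD g1 g2).
move=> x; rewrite big_cons /=; have := fE x; rewrite /vertex ea (negPf ob) /K.
have -> : b |: [set a] = [set a; b] by rewrite setUC.
have := hC' (a, b) x (mem_head _ _); rewrite /=.
have n1 : cell [set a] x -> cell [set b] x -> false.
  by move=> h1 h2; have /setP/(_ a) := cell_inj h1 h2; rewrite !inE eqxx (negPf ab).
have n2 : cell [set a] x -> cell [set a; b] x -> false.
  by move=> h1 h2; have /setP/(_ b) := cell_inj h1 h2; rewrite !inE eqxx eq_sym (negPf ab).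
have n3 : cell [set b] x -> cell [set a; b] x -> false.
  by move=> h1 h2; have /setP/(_ a) := cell_inj h1 h2; rewrite !inE eqxx (negPf ab).
have gt := @GT x; move: (\sum_(_ <- _) _) => S hC e.
rewrite [_ + _ + S]addnC addnACA e; move: n1 n2 n3 gt hC.
case: (cell [set a] x); case: (cell [set b] x); case: (cell [set a; b] x) => n1 n2 n3;
  try (by have := n1 isT isT); try (by have := n2 isT isT); try (by have := n3 isT isT);
  case: (G x); case: (T x); case: (C' x) => //= g h;
  try (by have := g isT); try (by have := h isT).
Qed.

(** Vertices lie in [T] and in disjoint cells. This keeps the truncated subtraction in
    [good_balanced] exact. *)
Lemma vertex_sum_le x : \sum_l vertex l x <= T x.
Proof.
case: (pickP (fun l => vertex l x)) => [l hl|h]; last by rewrite big1 // => l _; rewrite h.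
rewrite (bigD1 l) //= big1 => [|l' ll'].
  have : T x by move: hl => /andP[_]; case: ifP => _ => [/GT //|/andP[]].
  by rewrite hl => ->.
apply/eqP; rewrite eqb0; apply: contra ll' => /andP[cl' _]; move: hl => /andP[cl _].
by have /setP/(_ l') := cell_inj cl' cl; rewrite !inE eqxx => <-.
Qed.

(** The vertices missing from [V] are matched, even with odd, and [good_pairs] removes each pair. *)
Lemma good_balanced (V : {set L}) :
  #|[set l | ev l] :&: ~: V| = #|[set l | ~~ ev l] :&: ~: V| ->
  good (residue (fun x => T x - \sum_l vertex l x) vertex V).
Proof.
set E := _ :&: _; set O := _ :&: _ => EO.
have sz : size (enum E) = size (enum O) by rewrite -!cardE.
have [||||||f gf fE] := @good_pairs (zip (enum E) (enum O)) xpredT.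
- by exists 0.
- by [].
- by rewrite unzip1_zip ?enum_uniq // sz.
- by rewrite unzip2_zip ?enum_uniq // sz.
- move=> q qp; have := map_f snd qp; have := map_f fst qp.
  rewrite -/(unzip1 _) -/(unzip2 _) unzip1_zip ?unzip2_zip ?sz //.
  by rewrite !mem_enum !inE => /andP[-> _] /andP[-> _].
- by [].
apply: good_ext gf => x; have := fE x; rewrite andbT big_split /=.
have -> : \sum_(q <- zip (enum E) (enum O)) vertex q.1 x = \sum_(l in E) vertex l x.
  rewrite -(big_map fst xpredT (fun l => nat_of_bool (vertex l x))) -/(unzip1 _).
  by rewrite unzip1_zip ?sz // big_enum.
have -> : \sum_(q <- zip (enum E) (enum O)) vertex q.2 x = \sum_(l in O) vertex l x.
  rewrite -(big_map snd xpredT (fun l => nat_of_bool (vertex l x))) -/(unzip2 _).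
  by rewrite unzip2_zip ?sz // big_enum.
have := vertex_sum_le x; rewrite /residue.
have : \sum_l vertex l x =
    \sum_(l in V) vertex l x + (\sum_(l in E) vertex l x + \sum_(l in O) vertex l x).
  rewrite (bigID (mem V)) /=; congr (_ + _).
  rewrite (bigID ev) /=; congr (_ + _); apply: eq_bigl => l; rewrite !inE andbC //.
move: (\sum_l _) (\sum_(l in V) _) (\sum_(l in E) _) (\sum_(l in O) _) => s1 s2 s3 s4; lia.
Qed.

End Cube.

(** * Removing a set with few tails from a tiled set *)

Section Repair.

Variables (X : finType) (F : {pred {set X}}).

Local Notation point := (nat -> X).
Local Notation good := (good F).

Variable m : nat.
Hypothesis switch : forall (lam : 'I_m -> nat) (z : 'I_m -> X)
    (C G : pred point) (i : nat) (A : {set X}),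
  injective lam -> (exists d, dep d C) -> (exists d, dep d G) -> indep i C ->
  (forall l, indep (lam l) C) -> (forall l, indep (lam l) G) ->
  (forall l, i != lam l) -> A \in F -> (forall x, G x -> C x && (x i \in A)) ->
  good (fun x => (C x && (x i \in A)) && ~~ (G x && [forall l, x (lam l) == z l])).

Variables (d r : nat) (mu : 'I_m -> 'I_r) (Z : {set {ffun 'I_r -> X}}) (D : pred point).
Hypothesis mu_inj : injective mu.
Hypothesis mu_sep : forall z z', z \in Z -> z' \in Z ->
  (forall j, j \notin codom mu -> z j = z' j) -> z = z'.
Hypothesis D_dep : dep (d + r) D.
Hypothesis D_tail : forall x, D x -> [ffun j : 'I_r => x (d + j)] \in Z.

Let lam l := d + mu l.
Let lam_inj : injective lam. Proof. by move=> l l' /addnI/ord_inj/mu_inj. Qed.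

Let off (z : {ffun 'I_r -> X}) : {ffun 'I_r -> option X} :=
  [ffun j => if j \in codom mu then None else Some (z j)].
Let tail (x : point) : {ffun 'I_r -> X} := [ffun j : 'I_r => x (d + j)].

Let ovr (z : {ffun 'I_r -> X}) (x : point) : point :=
  fun j => if [pick l | lam l == j] is Some l then z (mu l) else x j.

Let off_tail_dep (V : Type) (f : {ffun 'I_r -> option X} -> V) :
  dep (d + r) (fun x => f (off (tail x))).
Proof.
by move=> x y xy; congr f; apply/ffunP=> j; rewrite !ffunE xy // ltn_add2l.
Qed.

Let off_tail_lam x l a : off (tail (upd x (lam l) a)) = off (tail x).
Proof.
apply/ffunP=> j; rewrite !ffunE /upd; case: ifP => // jmu; congr Some.
by rewrite /lam eqn_add2l; case: eqP => // /ord_inj jl; rewrite jl codom_f in jmu.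
Qed.

Let off_tail_lt x i a : i < d -> off (tail (upd x i a)) = off (tail x).
Proof.
move=> id; apply/ffunP=> j; rewrite !ffunE /upd.
by rewrite gtn_eqF // (leq_trans id) // leq_addr.
Qed.

(** Slicing by the tail values off [mu] leaves at most one tail of [Z] per slice, by [mu_sep]. So
    [D] cuts a single cell out of each slice, as [switch] allows. *)
Lemma brick_repair (C : pred point) i (A : {set X}) :
  dep d C -> i < d -> indep i C -> A \in F ->
  good (fun x => (C x && (x i \in A)) && ~~ D x).
Proof.
move=> dC id iC AF.
suff hs (s : {ffun 'I_r -> option X}) :
    good (fun x => ((C x && (off (tail x) == s)) && (x i \in A)) && ~~ D x).
  apply: good_ext (good_sum (index_enum _) (P := xpredT) (fun s _ => hs s)) => x.
  rewrite (bigD1 (off (tail x))) //= big1 ?addn0 ?eqxx ?andbT // => s.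
  by rewrite eq_sym => /negPf ->; rewrite andbF.
pose C' x := C x && (off (tail x) == s).
have dC' : dep (d + r) C'.
  move=> x y xy; rewrite /C' (dC x y); last first.
    by move=> j jd; apply: xy; apply: leq_trans jd (leq_addr _ _).
  by congr (_ && _); apply: (off_tail_dep (fun u => u == s)).
have iC' : indep i C' by move=> x a; rewrite /C' iC off_tail_lt.
have lC' l : indep (lam l) C'.
  by move=> x a; rewrite /C' off_tail_lam (dep_indep _ dC) // leq_addr.
have il l : i != lam l by rewrite ltn_eqF // (leq_trans id) // leq_addr.
(* If no tail in [Z] fits, [D] misses the slice, which is itself a brick. *)
case: (pickP [pred z in Z | off z == s]) => [z /= /andP[zZ /eqP zs]|nz]; last first.
  have : good (fun x => C' x && (x i \in A)) by apply: good_brick => //; exists (d + r).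
  apply: good_ext => x; rewrite -/(C' x) /C'; case: eqP => [xs|]; last by rewrite andbF.
  case Dx: (D x); last by rewrite !andbT.
  have : tail x \in Z := D_tail Dx.
  by have := nz (tail x); rewrite /= xs eqxx andbT => ->.
(* Overwriting the coordinates [lam] by [z] makes [G] independent of them; on the slice, [D] is [G]
   with those coordinates equal to [z]. *)
pose G x := (C' x && (x i \in A)) && D (ovr z x).
have ovr_lam x l a : D (ovr z (upd x (lam l) a)) = D (ovr z x).
  apply: D_dep => j _; rewrite /ovr /upd; case: pickP => // nl.
  by case: eqP => // jl; have := nl l; rewrite jl eqxx.
have dG : exists d, dep d G.
  exists (d + r) => x y xy; rewrite /G (dC' x y) // (xy i); last first.
    exact: leq_trans id (leq_addr _ _).
  by congr (_ && _); apply: D_dep => j jd; rewrite /ovr xy.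
have lG l : indep (lam l) G.
  by move=> x a; rewrite /G lC' ovr_lam /upd (negPf (il l)).
have eC' : exists d, dep d C' by exists (d + r).
have := @switch lam (fun l => z (mu l)) C' G i A lam_inj eC' dG iC' lC' lG il AF.
have GT x : G x -> C' x && (x i \in A) by case/andP.
move=> /(_ GT); apply: good_ext => x; rewrite -/(C' x); congr nat_of_bool.
case Tx: (C' x && (x i \in A)) => //=; congr (~~ _); rewrite /G Tx /=.
apply/andP/idP => [[Do /forallP h]|Dx].
  rewrite -(@D_dep (ovr z x)) // => j _; rewrite /ovr; case: pickP => // l /eqP <-.
  exact/esym/eqP.
have xz : tail x = z.
  apply: mu_sep (D_tail Dx) zZ _ => j jmu.
  move: Tx => /andP[/andP[_ /eqP xs] _]; have /ffunP/(_ j) : off (tail x) = off z by rewrite xs zs.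
  by rewrite !ffunE (negPf jmu) => -[].
have hx l : x (lam l) = z (mu l) by rewrite -xz ffunE.
split; last by apply/forallP=> l; rewrite hx.
rewrite (@D_dep _ x) // => j _; rewrite /ovr; case: pickP => // l /eqP <-.
by rewrite hx.
Qed.

Lemma tiled_repair h : tiled F d h -> good (fun x => h x * ~~ D x).
Proof.
elim=> [f f0|f g C i A dC id iC AF _ gg fE].
  by apply: good_ext (good0 F) => x; rewrite f0.
apply: good_ext (goodD (brick_repair dC id iC AF) gg) => x.
by rewrite fE mulnDl mulnb.
Qed.

End Repair.

(** * The abstract tiling theorem *)

Section Covers.

Variables (X : finType) (F : {pred {set X}}).

Local Notation point := (nat -> X).
Local Notation good := (good F).

Variables (t : nat) (KA : finType) (cov : KA -> {set X}).
Hypothesis t_gt0 : 0 < t.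
Hypothesis covF : forall k, cov k \in F.
Hypothesis cov_t : forall y, #|[set k | y \in cov k]| = t.

Lemma tile_through : exists tl : X -> {set X}, forall x, tl x \in F /\ x \in tl x.
Proof.
apply: (@fin_all_exists X (fun=> {set X}) (fun x A => A \in F /\ x \in A)) => x.
have : 0 < #|[set k | x \in cov k]| by rewrite cov_t.
by case/card_gt0P=> k; rewrite inE => xk; exists (cov k).
Qed.

(** Each of the [g] rounds removes exactly [t] pieces of [S]; the bound leaves at least [#|KA|]
    pieces at the start of every round. *)
Lemma good_remove_mul (I : finType) (H : point -> nat) (P : I -> pred point)
    (g : nat) (J S : {set I}) :
  (forall i, exists d, dep d (P i)) -> S \subset J -> #|KA| + t * g <= #|S| ->
  (forall D : {set I}, D \subset S -> #|D| = t * g -> good (residue H P (J :\: D))) ->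
  good (residue H P J).
Proof.
move=> dP; elim: g J S => [|g IH] J S SJ Sn hD.
  by rewrite -(setD0 J); apply: hD; rewrite ?sub0set // cards0 muln0.
apply: (good_remove covF dP SJ) => [|y D DS cD]; first by apply: leq_trans Sn; rewrite leq_addr.
rewrite cov_t in cD; apply: (IH _ (S :\: D)); first exact: setSD.
  by rewrite cardsD (setIidPr DS) cD; lia.
move=> E ES cE; rewrite setDDl; apply: hD.
  by rewrite subUset DS; apply: subset_trans ES (subsetDl _ _).
rewrite cardsU cD cE; have -> : D :&: E = set0; last by rewrite cards0; lia.
by apply/setP=> i; rewrite !inE; apply/andP=> -[iD /(subsetP ES)]; rewrite inE iD.
Qed.

(** While more than [#|KA|] pieces remain, another round removes [t > 0] of them. *)
Lemma good_few (I : finType) (H : point -> nat) (P : I -> pred point) (J : {set I}) :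
  (forall i, exists d, dep d (P i)) ->
  (forall J' : {set I}, J' \subset J -> #|J'| <= #|KA| -> good (residue H P J')) ->
  good (residue H P J).
Proof.
move=> dP; move Dn: #|J| => n; elim/ltn_ind: n => n IH in J Dn *.
move=> hJ; case: (leqP #|J| #|KA|) => [/hJ|Jn]; first exact.
apply: (good_remove covF dP (subxx J) (ltnW Jn)) => y D DJ; rewrite cov_t => cD.
apply: (IH #|J :\: D|) => // [|J' J'J]; last by apply: hJ; apply: subset_trans J'J (subsetDl _ _).
by rewrite -Dn cardsD (setIidPr DJ) cD; move: (subset_leq_card DJ); lia.
Qed.

(** The game is played on the points of the window until at most [#|KA|] survive. The survivors
    depend on the answers, which are read off later coordinates, so the bound holds once the
    coordinates from [b] on are fixed. *)
Lemma sparse_hole b : exists O : pred point,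
  [/\ exists d, dep d O, good (fun x => ~~ O x)
    & forall x, #|[set w : {ffun 'I_b -> X} | O (glue w x)]| <= #|KA|].
Proof.
suff main (J : {set {ffun 'I_b -> X}}) : exists O : pred point,
    [/\ exists d, dep d O, forall x, O x -> window b x \in J,
        good (fun x => (window b x \in J) && ~~ O x)
      & forall x, #|[set w : {ffun 'I_b -> X} | O (glue w x)]| <= #|KA|].
  have [O [dO _ gO sO]] := main setT; exists O; split=> //.
  by apply: good_ext gO => x; rewrite inE.
move Dn: #|J| => n; elim/ltn_ind: n => n IH in J Dn *.
case: (leqP #|J| #|KA|) => [Jn|/ltnW /inj_into[w w_inj wJ]].
  exists (fun x => window b x \in J); split=> // [||x].
  - by exists b; apply: (window_dep (fun w => w \in J)).
  - by apply: good_ext (good0 F) => x; rewrite andbN.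
  - apply: leq_trans Jn; apply/subset_leq_card/subsetP=> w.
    by rewrite inE window_glue.
pose D y := w @: [set k | y \in cov k].
have DJ y : D y \subset J by apply/subsetP=> i /imsetP[k _ ->].
have ltD y : #|J :\: D y| < n.
  have cD : #|D y| = t by rewrite card_imset ?cov_t.
  rewrite -Dn cardsD (setIidPr (DJ y)) cD; move: (subset_leq_card (DJ y)); lia.
have /fin_all_exists[O hO] y := IH _ (ltD y) _ erefl.
have /fin_all_exists[d hd] : forall y, exists d, dep d (O y) by move=> y; case: (hO y).
pose P k x := window b x == w k.
have dP k : exists d, dep d (P k) by exists b; apply: (window_dep (fun v => v == w k)).
have [|e0 he0] := good_play (R := fun y x => (window b x \in J :\: D y) && ~~ O y x) covF dP.
  by move=> y; case: (hO y).
(* Coordinate [e] lies beyond the window and all the [O y], so it records the answer without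
   disturbing them. *)
pose e := maxn e0 (maxn b (\max_y d y)).
have eb : b <= e by rewrite /e; lia.
have ed y : d y <= e by rewrite /e !leq_max leq_bigmax !orbT.
exists (fun x => O (x e) x); split.
- exists e.+1 => x y xy; rewrite (xy e) //; apply: (hd (y e)) => j jd.
  by apply: xy; apply: leq_trans jd (leqW (ed _)).
- by move=> x; case: (hO (x e)) => _ h _ _ /h; rewrite inE => /andP[].
- have := he0 e; rewrite /e leq_maxl => /(_ isT); rewrite -/e; apply: good_ext => x.
  case: (hO (x e)) => _ OJ _ _; rewrite inE.
  have -> : \sum_k (P k x && (x e \in cov k)) = (window b x \in D (x e)) :> nat.
    case: imsetP => [[k kx wk]|nD].
      rewrite (bigD1 k) //= big1 ?addn0 /P => [|k' k'k].
        by move: kx; rewrite inE => ->; rewrite wk eqxx.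
      by rewrite wk (inj_eq w_inj) eq_sym (negPf k'k).
    rewrite big1 // => k _; apply/eqP; rewrite eqb0; apply/negP=> /andP[/eqP wk kx].
    by apply: nD; exists k; rewrite ?inE.
  have := OJ x; rewrite inE; have := subsetP (DJ (x e)) (window b x).
  case: (_ \in D _); case: (_ \in J); case: (O _ x) => //= h1 h2;
    try (by have := h1 isT); by have := h2 isT.
- move=> x; case: (hO (x e)) => _ _ _; move=> /(_ x); apply: leq_trans.
  by apply/subset_leq_card/subsetP=> v; rewrite !inE glue_ge.
Qed.

Hypothesis prime_cover : forall p, prime p -> p %| t ->
  exists (KB : finType) (B : KB -> {set X}),
    (forall k, B k \in F) /\ forall y, #|[set k | y \in B k]| = 1 %[mod p].

(* Write [r = q * p]. Removing [s = 1] mod [q] pieces and then [v * c] further ones, where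
   [v = 1 - s] mod [r] (so that [q] divides [v]) and [c = 1] mod [p], removes [1] mod [r] pieces
   in total. *)
Lemma good_remove_mod1 (r : nat) : r %| t -> exists M, forall (I : finType)
    (H : point -> nat) (P : I -> pred point) (J S : {set I}),
  (forall i, exists d, dep d (P i)) -> S \subset J -> M <= #|S| ->
  (forall D : {set I}, D \subset S -> 0 < #|D| <= M -> #|D| = 1 %[mod r] ->
     good (residue H P (J :\: D))) ->
  good (residue H P J).
Proof.
elim/ltn_ind: r => r IH rt; have r_gt0 : 0 < r by apply: dvdn_gt0 rt.
case: (leqP r 1) => [r1|r_gt1].
  exists #|KA| => I H P J S dP SJ MS hD.
  apply: (good_remove covF dP SJ MS) => y D DS cD; apply: hD => //.
  - by rewrite cD max_card cov_t t_gt0.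
  - by rewrite (_ : r = 1) ?modn1 //; lia.
set p := pdiv r; have p_pr : prime p by apply: pdiv_prime.
have pr : p %| r by apply: pdiv_dvd.
have [q rE] := dvdnP pr; have p_gt1 := prime_gt1 p_pr.
have q_lt : q < r by rewrite rE in r_gt0 *; nia.
have [M hM] := IH q q_lt (dvdn_trans (dvdn_mulr p (dvdnn q)) (eq_ind r (dvdn^~ t) rt _ rE)).
have [KB [B [BF B1]]] := prime_cover p_pr (dvdn_trans pr rt).
(* Besides the at most [M] pieces for [q], fewer than [r] copies of each tile of [B] are played. *)
exists (M + r * #|KB|) => I H P J S dP SJ MS hD.
apply: (hM _ _ _ _ S) => // [|D DS /andP[D0 DM] D1]; first by apply: leq_trans MS; rewrite leq_addr.
(* This is [1 - #|D|] modulo [r], raised by [r * #|D|] to be a natural number. *)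
pose v := (r * #|D|).+1 - #|D|.
have vD : v + #|D| = r * #|D| + 1 by rewrite /v; nia.
pose v' := v %% r.
have q_v : q %| v.
  have : v + #|D| = 0 + #|D| %[mod q].
    by rewrite vD add0n D1 rE -mulnA mulnC modnMDl.
  by move/eqP; rewrite eqn_modDr mod0n.
have q_v' : q %| v'.
  by rewrite /v' /dvdn modn_dvdm ?rE ?dvdn_mulr // ; move: q_v; rewrite /dvdn.
have v'_lt : v' < r by rewrite ltn_mod.
apply: (@good_remove _ _ (KB * 'I_v')%type _ (fun k => B k.1) _ _ _ (S :\: D)) => //.
- exact: setSD.
- rewrite card_prod card_ord cardsD (setIidPr DS).
  have : #|KB| * v' <= r * #|KB| by rewrite mulnC leq_mul2r ltnW ?orbT.
  by move=> vr; rewrite leq_subRL ?subset_leq_card //; apply: leq_trans MS; apply: leq_add.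
move=> y E ES cE; rewrite setDDl; apply: hD.
- by rewrite subUset DS; apply: subset_trans ES (subsetDl _ _).
- have DE : D :&: E = set0.
    by apply/setP=> i; rewrite !inE; apply/andP=> -[iD /(subsetP ES)]; rewrite inE iD.
  rewrite cardsU DE cards0 subn0 addn_gt0 D0; apply: leq_add => //.
  rewrite cE; apply: leq_trans (max_card _) _.
  by rewrite card_prod card_ord mulnC leq_mul2r ltnW ?orbT.
have DE : D :&: E = set0.
  by apply/setP=> i; rewrite !inE; apply/andP=> -[iD /(subsetP ES)]; rewrite inE iD.
rewrite cardsU DE cards0 subn0 cE.
have -> : [set k : KB * 'I_v' | y \in B k.1] = setX [set k | y \in B k] setT.
  by apply/setP=> -[k j]; rewrite !inE andbT.
rewrite cardsX cardsT card_ord.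
set c := #|[set k | y \in B k]|; have c1 : c = 1 %[mod p] := B1 y.
have [w wE] := dvdnP q_v'.
(* [c - 1] is a multiple of [p] and [v'] one of [q], so their product vanishes modulo
   [r = q * p]. *)
have cv : c * v' = v' %[mod r].
  rewrite wE rE mulnA [c * w * q]mulnC [w * q]mulnC -!muln_modr.
  by rewrite -modnMml c1 modnMml mul1n.
by rewrite -modnDmr cv modnDmr addnC -modnDml modn_mod modnDml vD mulnC modnMDl.
Qed.

(* Remove [s = 1] mod [t] odd vertices of the cube, then [s - 1] even ones: together with the vertex
   [a0] to be removed, the removed sets are balanced. *)
Lemma good_switch : exists m, forall (lam : 'I_m -> nat) (z : 'I_m -> X)
    (C G : pred point) (i : nat) (A : {set X}),
  injective lam -> (exists d, dep d C) -> (exists d, dep d G) -> indep i C ->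
  (forall l, indep (lam l) C) -> (forall l, indep (lam l) G) ->
  (forall l, i != lam l) -> A \in F -> (forall x, G x -> C x && (x i \in A)) ->
  good (fun x => (C x && (x i \in A)) && ~~ (G x && [forall l, x (lam l) == z l])).
Proof.
have [tl htl] := tile_through.
have [M hM] := good_remove_mod1 (dvdnn t).
(* The labels below [m1] are even: [a0] and a pool of [#|KA| + M] others, enough to remove
   [#|D1| - 1] of them in rounds of [t]. The last [M] labels are the odd pool. *)
pose m1 := (#|KA| + M).+1; exists (m1 + M) => lam z C G i A lam_inj dC dG iC lC lG il AF GT.
pose ev : pred 'I_(m1 + M) := fun l => l < m1.
pose a0 : 'I_(m1 + M) := lshift M ord0.
(* The halves are swapped at [a0] so that the cell [[set a0]] says exactly [x (lam l) = z l] for all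
   [l]. *)
pose lo l := if l == a0 then tl (z l) :\ z l else [set z l].
pose hi l := if l == a0 then [set z l] else tl (z l) :\ z l.
have lohi l : lo l :&: hi l = set0.
  by rewrite /lo /hi; case: ifP => _; apply/setP=> a; rewrite !inE; case: eqP; rewrite ?andbF.
have lohiF l : lo l :|: hi l \in F.
  have [hF hz] := htl (z l).
  suff -> : lo l :|: hi l = tl (z l) by [].
  by rewrite /lo /hi; case: ifP => _; rewrite ?(setUC (_ :\ _)) setD1K.
pose T x := C x && (x i \in A).
pose v := vertex lam lo hi C G i A ev.
pose H x := T x - \sum_l v l x.
have dv l : exists d, dep d (v l) by apply: vertex_dep.
have sz (b : bool) : #|[set l | ev l == b]| = if b then m1 else M.
  rewrite -sum1_card big_mkcond big_split_ord /=.
  rewrite (eq_bigr (fun=> b : nat)) => [|l _]; last by rewrite !inE /ev /= ltn_ord; case: b.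
  rewrite [X in _ + X](eq_bigr (fun=> ~~ b : nat)) => [|l _].
    by rewrite !sum_nat_const !card_ord; case: b; rewrite ?muln1 ?muln0 ?addn0.
  by rewrite !inE /ev /= ltnNge leq_addr; case: b.
have g : good (residue H v (~: [set a0])).
  apply: (hM _ H v _ [set l | ev l == false]) => //.
  - by apply/subsetP=> l; rewrite !inE => /eqP hl; apply: contraFneq hl => ->.
  - by rewrite sz.
  move=> D1 D1S /andP[D1_gt0 D1M] D1_mod.
  have /dvdnP[g gE] : t %| #|D1|.-1.
    have : #|D1|.-1 + 1 = 0 + 1 %[mod t] by rewrite addn1 prednK.
    by move/eqP; rewrite eqn_modDr mod0n.
  have evK : [set l | ev l == true] = a0 |: [set l | ev l == true] :\ a0.
    by rewrite setD1K // inE.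
  have cE : #|[set l | ev l == true] :\ a0| = #|KA| + M.
    by have := sz true; rewrite (cardsD1 a0) inE /= /m1 => -[].
  have D1a : a0 \notin D1 by apply/negP=> /(subsetP D1S); rewrite inE.
  apply: (good_remove_mul (g := g) dv (S := [set l | ev l == true] :\ a0)).
  - apply/subsetP=> l; rewrite !inE => /andP[-> /eqP hl]; rewrite andbT.
    by apply/negP=> /(subsetP D1S); rewrite inE hl.
  - by rewrite cE leq_add2l mulnC -gE; apply: leq_trans D1M; apply: leq_pred.
  move=> D2 D2S cD2; apply: good_balanced => //.
  have -> : [set l | ev l] :&: ~: (~: [set a0] :\: D1 :\: D2) = a0 |: D2.
    apply/setP=> l; rewrite !inE; have := subsetP D2S l; have := subsetP D1S l; rewrite !inE.
    case: (eqVneq l a0) => [-> _ _|_] /=; first by rewrite !andbF.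
    by case: (l \in D1); case: (l \in D2); case: (ev l) => //= h1 h2;
      first [by have := h1 isT | by have := h2 isT].
  have -> : [set l | ~~ ev l] :&: ~: (~: [set a0] :\: D1 :\: D2) = D1.
    apply/setP=> l; rewrite !inE; have := subsetP D2S l; have := subsetP D1S l; rewrite !inE.
    case: (eqVneq l a0) => [-> _ _|_] /=; first by rewrite (negPf D1a).
    by case: (l \in D1); case: (l \in D2); case: (ev l) => //= h1 h2;
      first [by have := h1 isT | by have := h2 isT].
  rewrite cardsU1 cD2 mulnC -gE.
  have -> : a0 \notin D2 by apply/negP=> /(subsetP D2S); rewrite !inE eqxx.
  by rewrite add1n prednK.
apply: good_ext g => x; rewrite /residue.
have hs : \sum_l v l x <= T x := vertex_sum_le lam lohi GT ev x.
have -> : \sum_(l in ~: [set a0]) v l x = \sum_(l | l != a0) v l x.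
  by apply: eq_bigl => l; rewrite !inE.
have va : v a0 x = G x && [forall l, x (lam l) == z l].
  rewrite /v /vertex /ev /= andbC; congr (_ && _); apply: eq_forallb => l.
  by rewrite inE /lo /hi; case: (l == a0); rewrite inE.
move: hs; rewrite /H -/v -/(T x) (bigD1 a0) //= va.
case: (T x); case: (G x && _) => /=; move: (\sum_(l | _) _) => s; lia.
Qed.

(* The hole left by [sparse_hole] is cut into cells fixing many more coordinates and all but at most
   [#|KA|] of these are removed. Each survivor is covered by a line leaving the hole; the cells this
   line steals from the tiled part are repaired by [good_switch]. *)
Lemma good_one (x0 : X) : good (fun=> 1).
Proof.
have [tl htl] := tile_through.
have [m switch] := good_switch.
(* [2 * K < b] is what [free_direction] needs when fibres of the hole have at most [K] points. *)
pose K := #|KA|; pose b := (2 * K).+1.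
have [O [[d1 dO] [d2 tO] sO]] := sparse_hole b.
(* The hole and its tiling live below [d]; the next [r] coordinates have room for the [m] of
   [good_switch] and for separating [K] tails. *)
pose d := maxn b (maxn d1 d2); pose r := m + K * K; pose n := d + r.
have bd : b <= d by rewrite leq_maxl.
have bn : b <= n by rewrite (leq_trans bd) // leq_addr.
have {}dO : dep d O by apply: dep_leq dO; rewrite /d; lia.
have {}tO : tiled F d (fun x => ~~ O x) by apply: tiled_leq tO; rewrite /d; lia.
have dnO : dep n O by apply: dep_leq dO; rewrite leq_addr.
pose ext (c : {ffun 'I_n -> X}) : point := glue c (fun=> x0).
have extE (c : {ffun 'I_n -> X}) (j : 'I_n) : ext c j = c j by apply: glueE.
have ext_inj c c' : (forall j, j < n -> ext c j = ext c' j) -> c = c'.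
  by move=> h; apply/ffunP=> j; rewrite -!extE h.
have windowE (c : {ffun 'I_n -> X}) x : (window n x == c) = [forall j : 'I_n, x j == c j].
  apply/eqP/forallP=> [<- j|h]; first by rewrite ffunE.
  by apply/ffunP=> j; rewrite ffunE; apply/eqP.
pose J := [set c | O (ext c)].
have OJ x : O x = (window n x \in J).
  rewrite inE; apply: dnO => j jn.
  by rewrite -[j]/(nat_of_ord (Ordinal jn)) extE ffunE.
pose H x : nat := ~~ O x; pose P (c : {ffun 'I_n -> X}) (x : point) := window n x == c.
have dP c : exists d, dep d (P c) by exists n; apply: (window_dep (fun v => v == c)).
suff gJ : good (residue H P J).
  apply: good_ext gJ => x; rewrite /residue /H /P OJ; case: (boolP (_ \in J)) => xJ /=.
    rewrite (bigD1 (window n x)) //= eqxx big1 // => c /andP[_].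
    by rewrite eq_sym => /negPf ->.
  rewrite big1 // => c cJ; apply/eqP; rewrite eqb0; apply: contraNneq xJ => ->.
  exact: cJ.
apply: (good_few dP) => J' J'J cJ'.
have /fin_all_exists[l hl] (c : {ffun 'I_n -> X}) : exists l : 'I_b,
    forall w, O (glue w (ext c)) -> #|[set j | w j != window b (ext c) j]| <= 2 ->
    w l = ext c l.
  have [|l hl] := @free_direction X b [set w | O (glue w (ext c))] (window b (ext c)).
    by rewrite ltnS leq_mul2l sO.
  by exists l => w wO /(hl w); rewrite inE ffunE; apply.
pose near (c : {ffun 'I_n -> X}) (x : point) :=
  [forall j : 'I_n, (nat_of_ord j != l c) ==> (x j == c j)].
have nearP c x : near c x -> forall j, j < n -> j != l c -> x j = ext c j.
  move=> /forallP h j jn jl; have := h (Ordinal jn); rewrite /= jl => /eqP ->.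
  by rewrite -extE.
have ln c : l c < n by apply: leq_trans bn.
pose line c (x : point) := near c x && (x (l c) \in tl (ext c (l c))).
pose hit c (x : point) := line c x && (x (l c) != ext c (l c)).
have lineE c x : line c x = hit c x + P c x :> nat.
  have -> : P c x = near c x && (x (l c) == ext c (l c)).
    rewrite /P windowE; apply/forallP/andP=> [h|[nx /eqP xl] j].
      split; first by apply/forallP=> j; rewrite h implybT.
      by have := h (Ordinal (ln c)); rewrite -extE.
    rewrite -extE; case: (eqVneq (nat_of_ord j) (l c)) => [->|jl]; first by rewrite xl.
    by rewrite (nearP c).
  rewrite /hit /line; case: (near c x) => //=; case: eqP => [->|_]; last by rewrite andbT addn0.
  by have [_ ->] := htl (ext c (l c)).
(* Only coordinate [l c] moves along the line, and no hole point that close to [c] differs from it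
   there. *)
have hit_O c x : hit c x -> ~~ O x.
  move=> /andP[/andP[nx _] xl]; apply/negP=> Ox; case/eqP: xl.
  have := hl c (window b x); rewrite ffunE; apply.
    rewrite -(dnO x) // => j jn; case: (ltnP j b) => jb.
      by rewrite -[j]/(nat_of_ord (Ordinal jb)) glueE ffunE.
    by rewrite glue_ge // (nearP c) // gtn_eqF // (leq_trans _ jb).
  apply: leq_trans (_ : #|[set l c]| <= 2); last by rewrite cards1.
  apply/subset_leq_card/subsetP=> j; rewrite !inE !ffunE; apply: contraNT => jl.
  by rewrite (nearP c) // (leq_trans _ bn).
(* If two lines meet, their cells differ at most in [l c] and [l c']; this is why [free_direction]
   allows distance two. *)
have hit_inj c c' x : c' \in J' -> hit c x -> hit c' x -> c = c'.
  move=> c'J /andP[/andP[nx _] xl] /andP[/andP[nx' _] _].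
  have hcc' j : j < n -> j != l c -> j != l c' -> ext c j = ext c' j.
    by move=> jn jl jl'; rewrite -(nearP c x) // (nearP c').
  have e : ext c' (l c) = ext c (l c).
    have := hl c (window b (ext c')); rewrite ffunE; apply.
      rewrite -(dnO (ext c')); first by have := subsetP J'J _ c'J; rewrite inE.
      move=> j jn; case: (ltnP j b) => jb.
        by rewrite -[j]/(nat_of_ord (Ordinal jb)) glueE ffunE.
      by rewrite glue_ge // hcc' // gtn_eqF // (leq_trans _ jb).
    apply: leq_trans (_ : #|[set l c; l c']| <= 2); last by rewrite cards2; case: (_ == _).
    apply/subset_leq_card/subsetP=> j; rewrite !inE !ffunE; apply: contraNT.
    by rewrite negb_or => /andP[jl jl']; rewrite hcc' // (leq_trans _ bn).
  apply: ext_inj => j jn; case: (eqVneq j (l c)) => [->//|jl].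
  case: (eqVneq j (l c')) => [jl'|]; last exact: hcc'.
  by case/eqP: xl; rewrite -e; apply: nearP; rewrite // eq_sym -jl'.
pose D x := [exists c in J', hit c x].
have D_sum x : D x = \sum_(c in J') hit c x :> nat.
  rewrite /D; case: exists_inP => [[c cJ hc]|nD].
    rewrite (bigD1 c) //= hc big1 // => c' /andP[c'J c'c]; apply/eqP; rewrite eqb0.
    by apply: contra c'c => hc'; apply/eqP; apply: (hit_inj _ _ x).
  by rewrite big1 // => c cJ; apply/eqP; rewrite eqb0; apply/negP=> hc; apply: nD; exists c.
have dD : dep n D.
  move=> x y xy; apply: eq_existsb => c; congr (_ && _); rewrite /hit /line (xy (l c)) //.
  by congr (_ && _ && _); apply: eq_forallb => j; rewrite (xy j).
(* Lines move only coordinates below [b <= d], so the tails of [D] are those of the at most [K]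
   cells in [J']. *)
pose Z := [set [ffun j : 'I_r => ext c (d + j)] | c in J'].
have cZ : #|Z| <= K by apply: leq_trans (leq_imset_card _ _) cJ'.
have [|mu mu_inj mu_sep] := @separating_coords X m r Z.
  by rewrite leq_add2l leq_mul.
have D_tail x : D x -> [ffun j : 'I_r => x (d + j)] \in Z.
  move=> /exists_inP[c cJ /andP[/andP[nx _] _]]; apply/imsetP; exists c => //.
  apply/ffunP=> j; rewrite !ffunE (nearP c) ?ltn_add2l // gtn_eqF //.
  by apply: leq_trans (ltn_ord _) _; apply: leq_trans bd (leq_addr _ _).
have gD := tiled_repair switch mu_inj mu_sep dD D_tail tO.
have gl : good (fun x => \sum_(c in J') line c x).
  apply: good_sum => c _; apply: good_brick; last by case: (htl (ext c (l c))).
    by exists n => x y xy; apply: eq_forallb => j; rewrite xy.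
  move=> x a; apply: eq_forallb => j; rewrite /upd; case: eqP => //= /eqP.
(* The tiled part loses [D]; the lines put [D] back together with the cells of [J']. *)
apply: good_ext (goodD gD gl) => x; rewrite /residue /H.
rewrite (eq_bigr (fun c => hit c x + P c x)) => [|c _]; last exact: lineE.
rewrite big_split /= -D_sum addnA; congr (_ + _).
have : D x -> ~~ O x by case/exists_inP=> c _ /hit_O.
by case: (D x); case: (O x) => // /(_ isT).
Qed.

End Covers.

Import GRing.Theory.
Local Open Scope ring_scope.

(** * Covers of the torus modulo a prime *)

Section Invariants.

Variables (V : zmodType) (p : nat).
Hypothesis p_pr : prime p.

Local Notation fn := (V -> 'F_p).

Definition delta (v : V) (f : fn) : fn := fun x => f (x + v) - f x.

(** The sign has exponent [m + j] instead of [m - j] to avoid truncated subtraction. *)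
Lemma iter_delta (v : V) (f : fn) m x :
  iter m (delta v) f x = \sum_(j < m.+1) (-1) ^+ (m + j) *+ 'C(m, j) * f (x + v *+ j).
Proof.
elim: m x => [|m IH] x.
  by rewrite big_ord_recl big_ord0 /= expr0 mulr1n mul1r mulr0n !addr0.
rewrite iterS /delta !IH [RHS]big_ord_recl.
rewrite [X in _ - X](_ : _ =
  \sum_(j < m.+2) (-1) ^+ (m + j) *+ 'C(m, j) * f (x + v *+ j)); last first.
  by rewrite [RHS]big_ord_recr /= bin_small // mulr0n mul0r addr0.
rewrite [X in _ - X]big_ord_recl opprD addrCA; congr (_ + _).
  by rewrite !bin0 !addn0 exprS mulN1r !mulr1n mulNr.
rewrite -sumrN -big_split /=; apply: eq_bigr => j _.
rewrite /bump /= !add1n binS mulrnDr !addnS !addSn !exprS -addrA -mulrS.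
move: (f _) => y; move: ((-1) ^+ _) => a.
by rewrite !mulN1r opprK mulNrn mulNr opprK mulrDl addrC.
Qed.

(** All inner binomial coefficients vanish modulo [p]. *)
Lemma iter_delta_p (v : V) (f : fn) x : iter p (delta v) f x = f (x + v *+ p) - f x.
Proof.
rewrite iter_delta big_ord_recr /= (bigD1 (Ordinal (prime_gt0 p_pr))) //=.
rewrite big1 => [|j j0]; last first.
  have /dvdnP[c ->] : (p %| 'C(p, j))%N.
    by apply: prime_dvd_bin; rewrite ?ltn_ord // lt0n andbT.
  by rewrite -[_ *+ _]mulr_natr natrM (_ : p%:R = 0) ?mulr0 ?mul0r // pchar_Fp_0.
rewrite bin0 binn !mulr1n addn0 mulr0n !addr0.
rewrite addnn -mul2n exprM sqrrN !expr1n mul1r addrC.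
(* Fermat's little theorem treats [p = 2] and odd [p] alike. *)
suff -> : (-1) ^+ p = -1 :> 'F_p by rewrite mulN1r.
by rewrite -[X in _ ^+ X](card_Fp p_pr) expf_card.
Qed.

Definition shift_closed (P : fn -> Prop) : Prop := forall v f, P f -> P (delta v f).

Lemma invariant_of_nilpotent (P : fn -> Prop) (w : V) m (f : fn) :
  shift_closed P -> P f -> (exists x, f x != 0) -> (forall x, iter m (delta w) f x = 0) ->
  exists g, [/\ P g, exists x, g x != 0 & forall x, g (x + w) = g x].
Proof.
move=> cP; elim: m f => [|m IH] f Pf f0; first by case: f0 => x /eqP fx0 /(_ x).
move=> fm; case: (classic (exists x, delta w f x != 0)) => [d0|d0].
  by apply: (IH (delta w f)) => //; [apply: cP|move=> x; rewrite -iterSr fm].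
exists f; split=> // x; apply/eqP; rewrite -subr_eq0; apply/negPn/negP=> h.
by apply: d0; exists x.
Qed.

(** The [p]-th iterated difference along [w *+ (p ^ e)] is the difference along [w *+ (p ^ e.+1)],
    which kills [f]; so the exponent drops one at a time. *)
Lemma invariant_of_periodic (P : fn -> Prop) (w : V) e (f : fn) :
  shift_closed P -> P f -> (exists x, f x != 0) -> (forall x, f (x + w *+ (p ^ e)) = f x) ->
  exists g, [/\ P g, exists x, g x != 0 & forall x, g (x + w) = g x].
Proof.
move=> cP; elim: e f => [|e IH] f Pf f0 fw; first by exists f.
have [|g [Pg g0 gw]] := @invariant_of_nilpotent P (w *+ (p ^ e)) p f cP Pf f0.
  by move=> x; rewrite iter_delta_p -mulrnA -expnSr fw subrr.
exact: (IH g).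
Qed.

(** Vectors are treated one by one; [Q] records the invariances gained so far, which differences
    preserve. *)
Lemma invariant_list (P : fn -> Prop) e (f : fn) (s : seq V) :
  shift_closed P -> P f -> (exists x, f x != 0) -> (forall w x, f (x + w *+ (p ^ e)) = f x) ->
  exists g, [/\ P g, exists x, g x != 0, forall w x, g (x + w *+ (p ^ e)) = g x
    & forall w x, w \in s -> g (x + w) = g x].
Proof.
move=> cP Pf f0 fe; elim: s => [|w s [g [Pg g0 ge gs]]]; first by exists f.
pose Q (h : fn) := [/\ P h, forall v x, h (x + v *+ (p ^ e)) = h x
  & forall v x, v \in s -> h (x + v) = h x].
have cQ : shift_closed Q.
  move=> v h [Ph he hs]; split=> [|u x|u x us]; first exact: cP.
    by rewrite /delta [x + _ + v]addrAC !he.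
  by rewrite /delta [x + _ + v]addrAC !(hs u).
have [//|//|//|h [[Ph he hs] h0 hw]] := @invariant_of_periodic Q w e g cQ.
exists h; split=> // v x; rewrite inE => /predU1P[->//|]; exact: hs.
Qed.

End Invariants.

Section Residues.

Variable n : nat.

Lemma ptMn (w : pt n) q i : (w *+ q) i = w i * q%:Z.
Proof. by rewrite ffunMnE -mulr_natr natz. Qed.

Lemma ptB (x y : pt n) i : (x - y) i = x i - y i.
Proof. by rewrite !ffunE. Qed.

Definition inj_mod (T : {fset pt n}) (q : nat) : Prop :=
  forall s s', s \in T -> s' \in T -> (forall i, (q%:Z %| s i - s' i)%Z) -> s = s'.

(* Over a field of characteristic [p] the differences along a lattice of exponent [p ^ e] are
   nilpotent, so the nonzero convolution of [T] with the indicator of that lattice can be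
   differenced down to a nonzero constant. *)
Lemma mod_cover (T : {fset pt n}) p e :
  prime p -> T != fset0 -> inj_mod T (p ^ e)%N ->
  exists u : pt n -> 'F_p,
    (forall w x, u (x + w *+ (p ^ e)) = u x) /\ forall x, \sum_(s <- T) u (x - s) = 1.
Proof.
move=> p_pr /fset0Pn[s0 s0T] inj; set q := (p ^ e)%N in inj *.
pose P (f : pt n -> 'F_p) := exists u : pt n -> 'F_p,
  (forall w x, u (x + w *+ q) = u x) /\ forall x, f x = \sum_(s <- T) u (x - s).
have cP : shift_closed P.
  move=> v f [u [uq uf]]; exists (delta v u); split=> [w x|x].
    by rewrite /delta [x + _ + v]addrAC !uq.
  by rewrite /delta !uf -sumrB; apply: eq_bigr => s _; rewrite addrAC.
pose u0 (x : pt n) : 'F_p := [forall i, (q%:Z %| x i)%Z]%:R.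
have u0q w x : u0 (x + w *+ q) = u0 x.
  congr (_%:R); apply: congr1; apply: eq_forallb => i.
  by rewrite ffunE ptMn rpredDr ?dvdz_mull.
pose f0 x := \sum_(s <- T) u0 (x - s).
have f0P : P f0 by exists u0.
have f0s : f0 s0 != 0.
  rewrite /f0 (big_fsetD1 s0) //= big_seq big1 ?addr0 => [|s].
    rewrite /u0 subrr (_ : [forall i, _]) ?oner_eq0 //.
    by apply/forallP=> i; rewrite ffunE dvdz0.
  rewrite !inE => /andP[ss0 sT]; rewrite /u0; case: forallP => // h.
  by case/eqP: ss0; apply/esym/inj => // i; rewrite -ptB.
have f0q w x : f0 (x + w *+ q) = f0 x by apply: eq_bigr => s _; rewrite addrAC u0q.
pose ei (i : 'I_n) : pt n := [ffun j => (j == i)%:R].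
have [|g [[u [uq ug]] [x0 gx0] _ ge]] :=
  @invariant_list _ p p_pr P e f0 [seq ei i | i <- enum 'I_n] cP f0P _ f0q; first by exists s0.
(* The stabiliser of [g] is a subgroup containing the unit vectors, so [g] is constant. *)
pose st (v : pt n) := forall x, g (x + v) = g x.
have st0 : st 0 by move=> x; rewrite addr0.
have stD v w : st v -> st w -> st (v + w) by move=> hv hw x; rewrite addrA hw hv.
have stN v : st v -> st (- v) by move=> hv x; rewrite -{2}[x](subrK v) hv.
have stM v k : st v -> st (v *+ k).
  by move=> hv; elim: k => [|k IH] //; rewrite mulrS; apply: stD.
have stZ v (z : int) : st v -> st (v *~ z).
  by move=> hv; case: z => k; rewrite ?NegzE ?mulrNz; [|apply: stN]; apply: stM.
have gc x : g x = g x0.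
  have -> : x = x0 + \sum_i ei i *~ (x i - x0 i).
    apply/ffunP=> j; rewrite ffunE sum_ffunE (bigD1 j) //= big1 => [|i ij].
      by rewrite addr0 ffunMzE ffunE eqxx intz addrC subrK.
    by rewrite ffunMzE ffunE eq_sym (negPf ij) mul0rz.
  suff : st (\sum_i ei i *~ (x i - x0 i)) by apply.
  apply: (big_ind st) => // i _; apply: stZ => y; apply: ge.
  by apply: map_f; rewrite mem_enum.
exists (fun x => (g x0)^-1 * u x); split=> [w x|x]; first by rewrite uq.
by rewrite -mulr_sumr -ug gc mulVf.
Qed.

End Residues.

(** * Translates of the tile in the torus *)

Section Torus.

Variables (n k : nat).

Definition torus := {ffun 'I_n -> 'I_k.+1}.

Definition proj (x : pt n) : torus := [ffun i => inord `|(x i %% k.+1%:Z)%Z|%N].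

Definition rep (g : torus) : pt n := [ffun i => (g i)%:Z].

Lemma proj_eqP (x y : pt n) : reflect (forall i, (k.+1%:Z %| x i - y i)%Z) (proj x == proj y).
Proof.
have modE (z : int) : `|(z %% k.+1%:Z)%Z|%N%:Z = (z %% k.+1%:Z)%Z by rewrite gez0_abs // modz_ge0.
have mod_lt (z : int) : (`|(z %% k.+1%:Z)%Z| < k.+1)%N by rewrite -ltz_nat modE ltz_pmod.
apply: (iffP eqP) => [/ffunP xy i|xy].
  have := xy i; rewrite !ffunE => /(congr1 (@nat_of_ord _)); rewrite !inordK // => e.
  by rewrite -eqz_mod_dvd; apply/eqP; rewrite -[LHS]modE -[RHS]modE e.
apply/ffunP=> i; rewrite !ffunE; congr (inord `|_|%N); apply/eqP.
by rewrite eqz_mod_dvd.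
Qed.

Lemma proj_rep g : proj (rep g) = g.
Proof.
apply/ffunP=> i; rewrite !ffunE modz_small ?ltz_nat ?ltn_ord //=; exact: inord_val.
Qed.

Lemma projD (x y s : pt n) : proj x = proj y -> proj (x + s) = proj (y + s).
Proof.
move=> /eqP/proj_eqP xy; apply/eqP/proj_eqP=> i; have := xy i.
by rewrite !ffunE opprD addrACA subrr addr0.
Qed.

Lemma proj_period (x y : pt n) (R : Type) (u : pt n -> R) :
  (forall w x, u (x + w *+ k.+1) = u x) -> proj x = proj y -> u x = u y.
Proof.
move=> uk /eqP/proj_eqP xy.
have -> : x = y + [ffun i => ((x i - y i) %/ k.+1%:Z)%Z] *+ k.+1; last exact: uk.
by apply/ffunP=> i; rewrite ffunE ptMn ffunE divzK // addrC subrK.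
Qed.

Variable T : {fset pt n}.

Definition tile_at (g : torus) : {set torus} :=
  [set y | y \in [seq proj (rep g + s) | s <- T]].

Lemma mem_tile_at g y : (y \in tile_at g) = (g \in [seq proj (rep y - s) | s <- T]).
Proof.
rewrite inE; apply/mapP/mapP=> -[s sT E]; exists s => //; rewrite {}E.
  by rewrite -[LHS]proj_rep -[rep g in LHS](addrK s); apply: projD; rewrite proj_rep.
by rewrite -[LHS]proj_rep -[rep y in LHS](subrK s); apply: projD; rewrite proj_rep.
Qed.

Hypothesis T_inj : inj_mod T k.+1.

Lemma projB_inj y : {in T &, injective (fun s => proj (rep y - s))}.
Proof.
move=> s s' sT s'T /eqP/proj_eqP h; apply: T_inj => // i; have := h i.
have -> : s i - s' i = (rep y i - s' i) - (rep y i - s i) by ring.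
by rewrite !ptB -rpredN opprB.
Qed.

(** The translates through [y] are those by [y - s], and injectivity of [T] modulo [k.+1] lists each
    once. *)
Lemma sum_tile_at (y : torus) (f : torus -> nat) :
  (\sum_(g | y \in tile_at g) f g = \sum_(s <- T) f (proj (rep y - s)%R))%N.
Proof.
rewrite -(big_map (fun s => proj (rep y - s)) xpredT f) /= [RHS]big_uniq /=; last first.
  by rewrite map_inj_in_uniq ?fset_uniq //; apply: projB_inj.
by apply: eq_bigl => g; rewrite mem_tile_at.
Qed.

Definition torus_tiles : {pred {set torus}} := [pred A | [exists g, A == tile_at g]].

Lemma tile_at_in g : tile_at g \in torus_tiles.
Proof. by apply/existsP; exists g. Qed.

Lemma tile_at_cover y : #|[set g | y \in tile_at g]| = #|` T|.
Proof.
rewrite -sum1_card (eq_bigl (fun g => y \in tile_at g)) => [|g]; last by rewrite inE.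
by rewrite (sum_tile_at y (fun=> 1%N)) sum1_size.
Qed.

(** The translate by [g] is taken [f g < p] times, with [f g] the natural number representing the
    weight [u] at [g]. Periodicity makes [u] a function on the torus. *)
Lemma tile_prime_cover p e : prime p -> T != fset0 -> inj_mod T (p ^ e)%N ->
  (p ^ e %| k.+1)%N ->
  exists (KB : finType) (B : KB -> {set torus}),
    (forall b, B b \in torus_tiles) /\ forall y, (#|[set b | y \in B b]| = 1 %[mod p])%N.
Proof.
move=> p_pr T0 inj /dvdnP[c kE]; have [u [uq u1]] := mod_cover p_pr T0 inj.
have uk w x : u (x + w *+ k.+1) = u x by rewrite kE mulrnA uq.
pose f g : nat := u (rep g).
have f_lt g : (f g < p)%N.
  by apply: leq_trans (ltn_ord _) _; rewrite Fp_cast.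
exists {b : torus * 'I_p | (b.2 < f b.1)%N}, (fun b => tile_at (val b).1).
split=> [b|y]; first exact: tile_at_in.
have -> : #|[set b : {b : torus * 'I_p | (b.2 < f b.1)%N} | y \in tile_at (val b).1]| =
    (\sum_(g | y \in tile_at g) f g)%N.
  rewrite -(card_imset _ val_inj).
  have -> : [set val b | b in
        [set b : {b : torus * 'I_p | (b.2 < f b.1)%N} | y \in tile_at (val b).1]] =
      [set b : torus * 'I_p | (y \in tile_at b.1) && (b.2 < f b.1)%N].
    apply/setP=> b; rewrite inE; apply/imsetP/andP=> [[b' + ->]|[yb bf]].
      by rewrite inE => ->; split=> //; apply: (valP b').
    by exists (exist _ b bf); rewrite // in_set.
  rewrite -sum1_card.
  rewrite (eq_bigl (fun b : torus * 'I_p => (y \in tile_at b.1) && (b.2 < f b.1)%N)); last first.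
    by move=> b; rewrite inE.
  rewrite -(pair_big_dep (fun g => y \in tile_at g) (fun g (j : 'I_p) => (j < f g)%N)
    (fun _ _ => 1%N)) /=.
  by apply: eq_bigr => g _; rewrite (big_ord_narrow (ltnW (f_lt g))) /= sum1_card card_ord.
rewrite sum_tile_at -!(val_Fp_nat p_pr); congr (nat_of_ord _).
rewrite natr_sum -[RHS](u1 (rep y)); apply: eq_bigr => s _.
by rewrite /f natr_Zp; apply: proj_period uk _; rewrite proj_rep.
Qed.

End Torus.

(** * From the torus to the integer lattice *)

(** The derivation becomes an indexed family of bricks, whose indices later label the copies of the
    partition. *)
Lemma tiled_bricks (X : finType) (F : {pred {set X}}) D f : tiled F D f ->
  exists (m : nat) (C : nat -> pred (nat -> X)) (c : nat -> nat) (A : nat -> {set X}),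
    (forall b, (b < m)%N ->
      [/\ dep D (C b), (c b < D)%N, indep (c b) (C b) & A b \in F]) /\
    forall x, f x = (\sum_(b < m) (C b x && (x (c b) \in A b)))%N.
Proof.
elim=> [g g0|g h C0 i0 A0 dC id iC AF _ [m [C [c [A [wf hE]]]]] gE].
  by exists 0%N, (fun _ _ => false), (fun=> 0%N), (fun=> set0); split=> // x; rewrite big_ord0.
exists m.+1, (fun b => if b is b'.+1 then C b' else C0),
  (fun b => if b is b'.+1 then c b' else i0), (fun b => if b is b'.+1 then A b' else A0).
by split=> [[|b] //= /wf|x]; last by rewrite big_ord_recl gE hE.
Qed.

Section Blocks.

Variables (n D : nat).
Hypothesis n_gt0 : (0 < n)%N.

Let d := (D * n)%N.

(** The default 0 makes the blocks from [D] on vanish, so that a point yields an infinite sequence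
    of blocks. *)
Definition block (z : pt d) (j : nat) : pt n :=
  [ffun i : 'I_n => oapp z 0 (insub (j * n + i)%N)].

Definition put (j : nat) (s : pt n) : pt d :=
  [ffun q : 'I_d => if (q %/ n == j)%N then s (Ordinal (ltn_pmod q n_gt0)) else 0].

Lemma block_put a i s j : (i < D)%N ->
  block (a + put i s) j = if j == i then block a j + s else block a j.
Proof.
move=> iD; apply/ffunP=> l.
have lq : ((j * n + l) %/ n = j)%N by rewrite divnMDl // divn_small ?addn0.
have lr : ((j * n + l) %% n = l)%N by rewrite modnMDl modn_small.
case: (boolP (j == i)) => ji; rewrite !ffunE.
  have jd : (j * n + l < d)%N.
    rewrite /d (eqP ji) (leq_trans (_ : _ < i.+1 * n)%N) ?leq_mul2r ?iD ?orbT //.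
    by rewrite mulSn addnC ltn_add2r.
  rewrite (insubT (fun q => (q < d)%N) jd) /= !ffunE /= lq ji; congr (_ + s _).
  by apply: val_inj.
case: insubP => [q _ qE|] //=; rewrite !ffunE.
by rewrite -[nat_of_ord q]/(val q) qE lq (negPf ji) addr0.
Qed.

Lemma embed_put (x : pt n) : embed d x = put 0 x.
Proof.
apply/ffunP=> q; rewrite !ffunE; case: insubP => [j _ jE|].
  have qn : (q < n)%N by rewrite -[X in (X < _)%N]jE ltn_ord.
  rewrite divn_small // eqxx; congr (x _); apply: val_inj => /=.
  by rewrite modn_small // -jE.
by rewrite -leqNgt => nq; rewrite gtn_eqF // divn_gt0.
Qed.

Lemma dist2_put a i x y : (i < D)%N ->
  dist2 (a + put i x) (a + put i y) = \sum_(j < n) (x j - y j) ^+ 2.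
Proof.
move=> iD; rewrite /dist2.
have hq (j : 'I_n) : (i * n + j < d)%N.
  by rewrite /d (leq_trans (_ : _ < i.+1 * n)%N) ?leq_mul2r ?iD ?orbT // mulSn addnC ltn_add2r.
rewrite (bigID (fun q : 'I_d => (q %/ n == i)%N)) /=.
rewrite [X in _ + X]big1 ?addr0 => [|q /negPf qi]; last first.
  by rewrite !ffunE qi subrr expr0n.
rewrite (reindex_onto (fun j : 'I_n => Ordinal (hq j))
  (fun q => Ordinal (ltn_pmod q n_gt0))); last first.
  by move=> q /eqP qi; apply: val_inj; rewrite /= -qi -divn_eq.
apply: eq_big => [j|j _].
  rewrite /= divnMDl // divn_small // addn0 eqxx; apply/eqP/val_inj => /=.
  by rewrite modnMDl modn_small.
rewrite !ffunE /= divnMDl // divn_small // addn0 eqxx.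
rewrite (_ : Ordinal _ = j); last by apply: val_inj; rewrite /= modnMDl modn_small.
by rewrite opprD addrACA subrr add0r.
Qed.

End Blocks.

Section Lifting.

Variables (n k D : nat) (T : {fset pt n}).
Hypothesis n_gt0 : (0 < n)%N.
Hypothesis T_inj : inj_mod T k.+1.
Hypothesis D_tiled : tiled (@torus_tiles n k T) D (fun=> 1%N).

Let d := (D * n)%N.

Let code (z : pt d) : nat -> torus n k := fun j => proj k (block z j).

Let code_put a i s : (i < D)%N ->
  code (a + put D n_gt0 i s) =1 upd (code a) i (proj k (block a i + s)).
Proof. by move=> iD j; rewrite /code block_put // /upd; case: eqP => // ->. Qed.

(** Each brick pulls back along [code] to a disjoint union of copies of [T] placed in block [c b],
    one for each anchor [a] in the base whose block lies over [g b]. *)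
Lemma tiles_lift : (0 < D)%N -> tiles T d.
Proof.
move=> D_gt0; have [m [C [c [A [wf one]]]]] := tiled_bricks D_tiled.
have /fin_all_exists[g hg] (b : 'I_m) : exists g, A b = tile_at T g.
  by have [_ _ _ /existsP[g /eqP]] := wf b (ltn_ord b); exists g.
have C_put (b : 'I_m) a s : C b (code (a + put D n_gt0 (c b) s)) = C b (code a).
  have [dC cD iC _] := wf b (ltn_ord b).
  by rewrite -(iC (code a) (proj k (block a (c b) + s))); apply: dC => j _; apply: code_put.
pose I := {ba : 'I_m * pt d | C ba.1 (code ba.2) && (proj k (block ba.2 (c ba.1)) == g ba.1)}.
exists I, (fun (ba : I) (z : pt d) =>
  exists2 s, s \in T & z = (sval ba).2 + put D n_gt0 (c (sval ba).1) s).
split=> [[[b a] /= ba]|z].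
  have [_ cD _ _] := wf b (ltn_ord b).
  pose head (y : pt d) := block y 0.
  have headE s : head (embed d s) = s.
    rewrite /head embed_put -[put _ _ _ _]add0r block_put //=.
    by apply/ffunP=> i; rewrite !ffunE; case: insubP => [q _ _|_] /=; rewrite ?ffunE add0r.
  exists (fun y => a + put D n_gt0 (c b) (head y)); split=> [s sT|].
    by exists s; rewrite ?headE.
  split=> [_ [s sT ->]|s s' sT s'T]; first by exists s; rewrite ?headE.
  rewrite !headE dist2_put // !embed_put -[put D n_gt0 0 s]add0r.
  by rewrite -[put D n_gt0 0 s']add0r dist2_put.
have /eqP := one (code z); rewrite eq_sym => /eqP zone.
have [b zb] : exists b : 'I_m, C b (code z) && (code z (c b) \in A b).
  case: (pickP (fun b : 'I_m => C b (code z) && (code z (c b) \in A b))) => [b|h].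
    by exists b.
  by move: zone; rewrite big1 // => b _; rewrite h.
have b_uniq (b' : 'I_m) : C b' (code z) && (code z (c b') \in A b') -> b' = b.
  move=> zb'; apply/eqP; apply: contraTT (leqnn 1) => bb'.
  by rewrite -{1}zone (bigD1 b) //= (bigD1 b') //= zb zb'.
have [_ cD _ _] := wf b (ltn_ord b).
case/andP: (zb) => Cz; rewrite hg in_set => /mapP[s sT zs].
pose a := z + put D n_gt0 (c b) (- s).
have za : z = a + put D n_gt0 (c b) s.
  by apply/ffunP=> q; rewrite !ffunE; case: ifP => _; rewrite ?addr0 ?subrK.
have ba : C b (code a) && (proj k (block a (c b)) == g b).
  rewrite C_put Cz /= block_put // eqxx -(proj_rep (g b)) -(addrK s (rep (g b))).
  by apply/eqP/projD; exact: zs.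
exists (exist _ (b, a) ba); split=> [|[[b' a'] /= ba'] [s' s'T /= zs']]; first by exists s.
case/andP: (ba') => Ca' /eqP ga'.
have e : b' = b.
  have [_ cD' _ _] := wf b' (ltn_ord b').
  apply: b_uniq; rewrite zs' C_put Ca' /= code_put // /upd eqxx hg in_set.
  apply/mapP; exists s' => //; apply: projD; by rewrite ga' proj_rep.
subst b'.
(* Injectivity of [T] modulo [k.+1] recovers [s], and with it the anchor. *)
have ss' : s' = s.
  have : proj k (rep (g b) + s') = proj k (rep (g b) + s).
    rewrite -zs [in RHS]/code zs' block_put // eqxx; apply: projD.
    by rewrite proj_rep ga'.
  move=> /eqP/proj_eqP h; apply: T_inj => // i; have := h i.
  by rewrite !ffunE opprD addrACA subrr add0r.
apply: val_inj => /=; congr pair; apply: (addIr (put D n_gt0 (c b) s)).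
by rewrite -za zs' ss'.
Qed.

End Lifting.

(** * Choice of the modulus and conclusion *)

Lemma inj_mod_large n (T : {fset pt n}) :
  exists e : nat, forall q, (2 ^ e <= q)%N -> inj_mod T q.
Proof.
(* Coordinate differences are at most [2 * N < 2 ^ (2 * N)]. A power of two as threshold serves
   [p ^ e] for all primes [p] at once. *)
pose N := (\sum_(s <- T) \sum_i `|s i|)%N; exists N.*2 => q Nq s s' sT s'T h.
have bound (u : pt n) i : u \in T -> (`|u i| <= N)%N.
  move=> uT; rewrite /N (big_fsetD1 u) //= (bigD1 i) //= -addnA; exact: leq_addr.
apply/ffunP=> i; apply/eqP; rewrite -subr_eq0 -absz_eq0; apply: contraT; rewrite -lt0n => pos.
have := h i; rewrite dvdzE /= => /(dvdn_leq pos).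
have := bound s i sT; have := bound s' i s'T; have := ltn_expl N.*2 (ltnSn 1).
move: Nq; move: (2 ^ _)%N (s i) (s' i) => M a b.
lia.
Qed.

Theorem theorem1 (n : nat) (T : {fset pt n}) :
  (1 <= n)%N -> is_tile T -> exists d : nat, (n <= d)%N /\ tiles T d.
Proof.
move=> n_gt0 T0; have [e inj] := inj_mod_large T.
have t_gt0 : (0 < #|` T|)%N by rewrite cardfs_gt0.
(* Every prime [p] dividing [#|T|] has [p ^ e] dividing [k.+1]; the factor 2 ensures [2 ^ e <= k.+1]
   even for a one-point tile. *)
pose k := ((2 * #|` T|) ^ e).-1.
have kE : k.+1 = ((2 * #|` T|) ^ e)%N by rewrite prednK // expn_gt0 muln_gt0 t_gt0.
have T_inj : inj_mod T k.+1.
  by apply: inj; rewrite kE expnMn leq_pmulr // expn_gt0 t_gt0.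
have [|D tD] := good_one t_gt0 (@tile_at_in n k T) (tile_at_cover T_inj) _ [ffun=> ord0].
  move=> p p_pr pT; apply: (tile_prime_cover T_inj (e := e)) => //.
    by apply: inj; case: (e) => // e'; rewrite leq_exp2r // prime_gt1.
  by rewrite kE dvdn_exp2r // dvdn_mull.
(* The successor keeps the dimension at least [n] when [D] is zero. *)
exists (D.+1 * n)%N; split; first by rewrite leq_pmull.
by apply: tiles_lift T_inj _ _ => //; apply: tiled_leq tD.
Qed.
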